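(* Let $G$ be an abelian, locally quasiconvex, locally $k_\omega$-group. If $\{g_n\}_{n<\omega}$ is a sequence in $G$ that is not precompact in $G$, then $\{g_n\}_{n<\omega}$ contains an $I_0$-set.
   Context: All topological spaces are assumed to be infinite, completely regular and Hausdorff. A Hausdorff space $X$ is a $k_\omega$-space if there is an ascending sequence of compact subsets $K_1\subseteq K_2\subseteq\cdots\subseteq X$ with $X=\bigcup_{n<\omega}K_n$ such that $U\subseteq X$ is open if and only if $U\cap K_n$ is open in $K_n$ for each $n$. A Hausdorff space is locally $k_\omega$ if each point has an open neighbourhood that is a $k_\omega$-space in the induced topology. A locally $k_\omega$-group is a topological group whose underlying space is locally $k_\omega$. For an abelian topological group $G$, $\widehat G$ is the group of continuous characters $\chi\colon G\to\mathbb{T}$, with $\mathbb{T}$ identified with the additive group $[-1/2,1/2)$ (modulo 1). For $A\subseteq G$ put $A^{\rhd}=\{\chi\in\widehat G:|\chi(a)|\le 1/4\ \text{for all } a\in A\}$, and for $X\subseteq\widehat G$ put $X^{\lhd}=\{g\in G:|\chi(g)|\le1/4\ \text{for all }\chi\in X\}$. A set $A\subseteq G$ is quasiconvex if $A^{\rhd\lhd}=A$, and $G$ is locally quasiconvex if it has a neighbourhood base at $0$ consisting of quasiconvex sets. A subset $A\subseteq G$ is precompact if for every neighbourhood $U$ of $0$ there is a finite $F\subseteq G$ with $A\subseteq F+U$; a sequence is precompact if its set of terms is. The Bohr compactification of $G$ is a pair $(bG,b)$ with $bG$ a compact Hausdorff group and $b$ a continuous homomorphism of $G$ onto a dense subgroup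 of $bG$ such that every continuous homomorphism $h\colon G\to K$ into a compact group extends to a continuous homomorphism $h^b\colon bG\to K$ with $h=h^b\circ b$. For a locally quasiconvex (Hausdorff) abelian group, $b$ is injective and $G$ is regarded as a subgroup of $bG$ algebraically. A subset $E\subseteq G$ is an $I_0$-set if each bounded function $f\colon E\to\mathbb{C}$ extends to a continuous function on $bG$ (equivalently, is the restriction to $E$ of an almost periodic function on $G$). *)

(* Defs.v *)
From HB Require Import structures.
From mathcomp Require Import all_boot all_order all_algebra ring lra complex.
From mathcomp Require Import all_classical all_reals topology normedtype.

Set Implicit Arguments.
Unset Strict Implicit.
Unset Printing Implicit Defensive.

Import Order.TTheory GRing.Theory Num.Theory.
Import numFieldNormedType.Exports.
Local Open Scope classical_set_scope.
Local Open Scope ring_scope.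
Local Open Scope complex_scope.

(* The topological group T = R / Z, carried by the representatives in
   [-1/2, 1/2[, with addition modulo 1 and the quotient topology. *)
Record circle (R : realType) := Circle {
  circle_val : R ;
  circle_valP : - 2^-1 <= circle_val < 2^-1 }.

HB.instance Definition _ (R : realType) := [isSub for @circle_val R].
HB.instance Definition _ (R : realType) := [Choice of circle R by <:].

Section circle_group.
Variable R : realType.
Implicit Types (x y z : circle R) (s t : R) (n : int).

Fact circle_proj_subproof t :
  - 2^-1 <= t - (Num.floor (t + 2^-1))%:~R < 2^-1.
Proof.
have := floor_itv (t + 2^-1); set m := Num.floor _.
rewrite intrD1 => /andP[h1 h2]; apply/andP; split; lra.
Qed.

Definition circle_proj t : circle R := Circle (circle_proj_subproof t).

Lemma circle_valK x : circle_proj (circle_val x) = x.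
Proof.
apply: val_inj => /=; rewrite (_ : Num.floor _ = 0) ?subr0//.
apply: floor_def; have /andP[h1 h2] := circle_valP x.
by rewrite add0r /=; apply/andP; split; lra.
Qed.

Lemma circle_projDz t n : circle_proj (t + n%:~R) = circle_proj t.
Proof.
apply: val_inj => /=.
have -> : t + n%:~R + 2^-1 = t + 2^-1 + n%:~R by ring.
by rewrite floorDrz ?intr_int// intrKfloor intrD; ring.
Qed.

Lemma circle_projP t : exists n, t = circle_val (circle_proj t) + n%:~R.
Proof. by exists (Num.floor (t + 2^-1)); rewrite /= subrK. Qed.

Definition circle_add x y : circle R := circle_proj (circle_val x + circle_val y).
Definition circle_opp x : circle R := circle_proj (- circle_val x).

Let projD s t :
  circle_add (circle_proj s) (circle_proj t) = circle_proj (s + t).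
Proof.
have [m hm] := circle_projP s; have [n hn] := circle_projP t.
rewrite [in RHS]hm [in RHS]hn.
rewrite (_ : _ + _ + _ = circle_val (circle_proj s) + circle_val (circle_proj t) + (m + n)%:~R).
  by rewrite circle_projDz.
by rewrite intrD; ring.
Qed.

Let addA : associative circle_add.
Proof.
move=> x y z; rewrite -(circle_valK x) -(circle_valK y) -(circle_valK z).
by rewrite !projD addrA.
Qed.

Let addC : commutative circle_add.
Proof. by move=> x y; rewrite /circle_add addrC. Qed.

Let add0 : left_id (circle_proj 0) circle_add.
Proof. by move=> x; rewrite -(circle_valK x) projD add0r. Qed.

Let addN : left_inverse (circle_proj 0) circle_opp circle_add.
Proof.
by move=> x; rewrite -{2}(circle_valK x) /circle_opp projD addNr.
Qed.

HB.instance Definition _ := GRing.isZmodule.Build (circle R) addA addC add0 addN.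

Lemma circle_projD : {morph circle_proj : s t / s + t}.
Proof. by move=> s t; rewrite -projD. Qed.

Lemma circle_projN : {morph circle_proj : t / - t}.
Proof.
move=> t; apply: (@addrI _ (circle_proj t)).
by rewrite -circle_projD !subrr.
Qed.

Definition circle_open : set_system (circle R) :=
  [set A | open (circle_proj @^-1` A)].

Let circle_openT : circle_open setT.
Proof. by rewrite /circle_open/= preimage_setT; exact: openT. Qed.

Let circle_openI : setI_closed circle_open.
Proof. by move=> A B oA oB; rewrite /circle_open/= preimage_setI; exact: openI. Qed.

Let circle_open_bigU (I : Type) (f : I -> set (circle R)) :
  (forall i, circle_open (f i)) -> circle_open (\bigcup_i f i).
Proof.
by move=> of_; rewrite /circle_open/= preimage_bigcup; apply: bigcup_open => i _; exact: of_.
Qed.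

HB.instance Definition _ := isOpenTopological.Build (circle R)
  circle_openT circle_openI circle_open_bigU.

Lemma circle_proj_continuous : continuous circle_proj.
Proof. by apply/continuousP => A; rewrite {1}/open. Qed.

Lemma circle_proj_open (A : set R) : open A -> open (circle_proj @` A).
Proof.
move=> oA; rewrite /open/= /circle_open/=.
rewrite (_ : _ @^-1` _ = \bigcup_(n : int) ((fun t : R => t + n%:~R) @^-1` A)).
  apply: bigcup_open => n _; move: A oA; apply/continuousP => t.
  by apply: cvgD; [exact: cvg_id|exact: cvg_cst].
apply/seteqP; split=> [t [s As st]|t [n _ /= Atn]]; last first.
  by exists (t + n%:~R) => //; rewrite circle_projDz.
have [m hm] := circle_projP s; have [n hn] := circle_projP t.
exists (m - n) => //=; suff -> : t + (m - n)%:~R = s by [].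
by rewrite intrB; rewrite st in hm; lra.
Qed.

Lemma nbhs_circle_proj t (A : set (circle R)) :
  nbhs (circle_proj t) A <-> nbhs t (circle_proj @^-1` A).
Proof.
split; first exact: circle_proj_continuous.
rewrite !nbhsE => -[B [oB Bt] BA]; exists (circle_proj @` B).
  by split; [exact: circle_proj_open|exists t].
by move=> _ [s Bs <-]; exact: BA.
Qed.

Let circle_sub_continuous : continuous (fun z : circle R * circle R => z.1 - z.2).
Proof.
move=> [x y]; rewrite -(circle_valK x) -(circle_valK y) => A /=.
rewrite -circle_projN -circle_projD => /nbhs_circle_proj.
set s := circle_val x; set t := circle_val y => nA.
have : (fun z : R * R => z.1 - z.2) @ (s, t) --> s - t.
  by apply: cvgB; [exact: cvg_fst|exact: cvg_snd].
move=> /(_ _ nA)[[/= B C] [nB nC] BC].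
exists (circle_proj @` B, circle_proj @` C); first split=> /=.
- by apply/nbhs_circle_proj; apply: filterS nB => u Bu; exists u.
- by apply/nbhs_circle_proj; apply: filterS nC => u Cu; exists u.
move=> [_ _] [/= [u Bu <-] [v Cv <-]].
by rewrite /= -circle_projN -circle_projD; exact: (BC (u, v)).
Qed.

HB.instance Definition _ := PreTopologicalNmodule_isTopologicalZmodule.Build
  (circle R) circle_sub_continuous.

End circle_group.

Section characters.
Variables (R : realType) (G : topologicalZmodType).

Definition dual : set (G -> circle R) :=
  [set chi | continuous chi /\ {morph chi : x y / x + y}].

Definition polar (A : set G) : set (G -> circle R) :=
  [set chi | dual chi /\ forall a, A a -> `|circle_val (chi a)| <= 4^-1].

Definition prepolar (X : set (G -> circle R)) : set G :=
  [set g | forall chi, X chi -> `|circle_val (chi g)| <= 4^-1].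

Definition quasiconvex (A : set G) := prepolar (polar A) = A.

Definition locally_quasiconvex :=
  forall U : set G, nbhs 0 U ->
    exists V : set G, [/\ nbhs 0 V, quasiconvex V & V `<=` U].

End characters.

(* [set_type A] carries the subspace topology, so [set_val @^-1` U] is the
   trace of U on A, seen as a subset of the space A. *)
Definition k_omega_space (X : topologicalType) :=
  hausdorff_space X /\
  exists K : nat -> set X,
    [/\ forall n, compact (K n),
        forall n, K n `<=` K n.+1,
        \bigcup_n K n = setT &
        forall U : set X,
          open U <-> forall n, open (set_val @^-1` U : set (set_type (K n)))].

Definition locally_k_omega (X : topologicalType) :=
  hausdorff_space X /\
  forall x : X, exists U : set X, [/\ open U, U x & k_omega_space (set_type U)].

(* Precompactness for the group uniformity; the library's [precompact] means
   instead that the closure is compact. *)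
Definition group_precompact (G : topologicalZmodType) (A : set G) :=
  forall U : set G, nbhs 0 U ->
    exists F : set G, finite_set F /\ A `<=` [set f + u | f in F & u in U].

(* Topological groups, not necessarily abelian, in multiplicative notation. *)
HB.mixin Record isTopologicalGroup G & Topological G & Group G := {
  mulg_continuous : continuous (fun x : G * G => (x.1 * x.2)%g) ;
  invg_continuous : continuous (fun x : G => (x^-1)%g) }.

#[short(type="topologicalGroupType")]
HB.structure Definition TopologicalGroup :=
  {G of Topological G & Group G & isTopologicalGroup G}.

Record is_bohr_compactification (G : topologicalZmodType)
    (bG : topologicalGroupType) (b : G -> bG) : Prop := {
  bohr_compact : compact [set: bG] ;
  bohr_hausdorff : hausdorff_space bG ;
  bohr_continuous : continuous b ;
  bohr_morph : {morph b : x y / x + y >-> (x * y)%g} ;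
  bohr_dense : dense (range b) ;
  bohr_extension : forall (K : topologicalGroupType) (h : G -> K),
    compact [set: K] -> hausdorff_space K ->
    continuous h -> {morph h : x y / x + y >-> (x * y)%g} ->
    exists hb : bG -> K,
      [/\ continuous hb, {morph hb : x y / (x * y)%g} & h = hb \o b] }.

Definition I0_set (R : realType) (G : Type) (bG : topologicalType)
    (b : G -> bG) (E : set G) :=
  forall f : G -> R[i],
    (exists M : R, forall x, E x -> `|f x| <= M%:C) ->
    exists F : bG -> R[i]^o, continuous F /\ forall x, E x -> F (b x) = f x.

(* Main.v *)
(* Pass to a subsequence with g j - g i outside a quasiconvex neighbourhood V of 0
   for i < j.  As the quasiconvex hull of a precompact set P is precompact, some
   character that is small on P is larger than 1/4 at some g n; subtracting a
   second such character, chosen by pigeonhole to be close to the first along a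
   further subsequence, keeps it large at g n and makes it small at all later
   terms.  A recursion yields a subsequence h and characters psi i with
   |psi i (h i)| >= 1/8 that are summably small at the other terms of h and on the
   i-th compact set of a k_omega-neighbourhood of 0.  For each set A of indices, an
   ultrafilter limit of the partial sums of (psi i), i in A, is a homomorphism on
   all of G; it is continuous, being a uniform limit on those compact sets, and it
   is large exactly at the h i with i in A.  Extended to bG, these characters
   interpolate arbitrary signs on h, and binary digits reduce bounded functions to
   signs. *)
Require Import Defs.
From HB Require Import structures.
From mathcomp Require Import all_boot all_order all_algebra ring lra complex.
From mathcomp Require Import all_classical all_reals topology normedtype.

Set Implicit Arguments.
Unset Strict Implicit.
Unset Printing Implicit Defensive.

Import Order.TTheory GRing.Theory Num.Theory.
Import numFieldNormedType.Exports.
Local Open Scope classical_set_scope.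
Local Open Scope ring_scope.

(** * The distance to 0 on the circle *)

Definition circle_norm {R : realType} (x : circle R) : R := `|circle_val x|.

Section CircleNorm.
Context {R : realType}.
Implicit Types (x y z : circle R) (t : R).

Lemma circle_val_small t : - 2^-1 <= t < 2^-1 -> circle_val (circle_proj t) = t.
Proof.
move=> /andP[h1 h2] /=; rewrite (_ : Num.floor _ = 0) ?subr0//.
by apply: floor_def; rewrite add0r /=; apply/andP; split; lra.
Qed.

Lemma circle_norm_ge0 x : 0 <= circle_norm x.
Proof. exact: normr_ge0. Qed.

Lemma circle_norm_le x : circle_norm x <= 2^-1.
Proof. by have /andP[h1 h2] := circle_valP x; rewrite ler_norml; lra. Qed.

Lemma circle_norm_small t : `|t| <= 2^-1 -> circle_norm (circle_proj t) = `|t|.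
Proof.
rewrite ler_norml => /andP[h1]; rewrite le_eqVlt => /orP[/eqP->|h2].
  (* The endpoint 1/2 is outside the half-open interval of representatives; modulo 1 it is -1/2, of
     the same absolute value. *)
  have -> : (2^-1 : R) = - 2^-1 + 1%:~R by rewrite mulr1z; lra.
  rewrite circle_projDz /circle_norm circle_val_small ?normrN.
    by rewrite !ger0_norm//; lra.
  by apply/andP; split; lra.
by rewrite /circle_norm circle_val_small// h1 h2.
Qed.

Lemma circle_norm_proj t : circle_norm (circle_proj t) <= `|t|.
Proof.
have [/circle_norm_small->//|/ltW] := leP `|t| 2^-1.
exact/le_trans/circle_norm_le.
Qed.

Lemma circle_normD x y : circle_norm (x + y) <= circle_norm x + circle_norm y.
Proof. exact: le_trans (circle_norm_proj _) (ler_normD _ _). Qed.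

Lemma circle_normN x : circle_norm (- x) = circle_norm x.
Proof.
have le y : circle_norm (- y) <= circle_norm y.
  by apply: le_trans (circle_norm_proj _) _; rewrite normrN.
by apply/eqP; rewrite eq_le le -{1}(opprK x) le.
Qed.

Lemma circle_normB x y : circle_norm (x - y) <= circle_norm x + circle_norm y.
Proof. by rewrite -(circle_normN y); exact: circle_normD. Qed.

Lemma circle_distC x y : circle_norm (x - y) = circle_norm (y - x).
Proof. by rewrite -circle_normN opprB. Qed.

Lemma circle_norm_lerB x y : circle_norm x - circle_norm y <= circle_norm (x - y).
Proof. by rewrite lerBlDr -{1}(subrK y x); exact: circle_normD. Qed.

Lemma circle_norm0 : circle_norm (0 : circle R) = 0.
Proof.
apply/eqP; rewrite eq_le circle_norm_ge0 andbT -(normr0 R).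
exact: (circle_norm_proj 0).
Qed.

Lemma circle_norm_eq0 x : circle_norm x = 0 -> x = 0.
Proof. by move/eqP; rewrite normr_eq0 => /eqP h; rewrite -(circle_valK x) h. Qed.

Lemma circle_normMn_small n x : circle_norm x *+ n <= 2^-1 ->
  circle_norm (x *+ n) = circle_norm x *+ n.
Proof.
rewrite /circle_norm -normrMn => /circle_norm_small <-; congr circle_norm.
rewrite -{1}(circle_valK x).
elim: n => [|n IH]; first by rewrite !mulr0n.
by rewrite !mulrS circle_projD IH.
Qed.

Lemma circle_normMn n x : circle_norm (x *+ n) <= circle_norm x *+ n.
Proof.
elim: n => [|n IH]; first by rewrite !mulr0n circle_norm0.
by rewrite !mulrS; apply: le_trans (circle_normD _ _) _; rewrite lerD2l.
Qed.

(** Multiples that stay within 1/4 of 0 cannot wrap around: bounds [c] on [x] and on [n] times its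
    norm keep the next multiple below 1/2, where the norm is exactly multiplicative. This turns the
    fixed bound 1/4 of a polar into arbitrarily small ones. *)
Lemma circle_norm_mulrn_le n x (c : R) : c <= 4^-1 ->
  (forall j, (j <= n)%N -> circle_norm (x *+ j) <= c) -> circle_norm x *+ n <= c.
Proof.
move=> c4; elim: n => [|n IH] h.
  by have := h 0%N isT; rewrite mulr0n circle_norm0 mulr0n.
have h1 : circle_norm x <= c by rewrite -(mulr1n x) h.
rewrite -circle_normMn_small ?h// mulrS.
have := IH (fun j jn => h j (leqW jn)); lra.
Qed.

Lemma nbhs_circleP x (A : set (circle R)) :
  nbhs x A <-> exists2 e : R, 0 < e & forall y, circle_norm (y - x) < e -> A y.
Proof.
rewrite -{1}(circle_valK x) nbhs_circle_proj; split.
  move/nbhs_ballP => [e /= e0 h]; exists e => // y yx.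
  rewrite -(subrK x y) addrC -(circle_valK (y - x)) -{1}(circle_valK x) -circle_projD.
  by apply: h; rewrite /ball/= opprD addrA subrr add0r normrN.
move=> [e e0 h]; apply/nbhs_ballP; exists e => // t; rewrite /ball/= => ht.
apply: h; rewrite -{1}(circle_valK x) -circle_projN -circle_projD.
by apply: le_lt_trans (circle_norm_proj _) _; rewrite distrC.
Qed.

Lemma circle_hausdorff : hausdorff_space (circle R).
Proof.
move=> x y h; apply/subr0_eq/circle_norm_eq0/eqP.
rewrite eq_le circle_norm_ge0 andbT leNgt; apply/negP => d0.
have [||z [/= zx zy]] := h [set z | circle_norm (z - x) < circle_norm (x - y) / 2]
                  [set z | circle_norm (z - y) < circle_norm (x - y) / 2].
- by apply/nbhs_circleP; exists (circle_norm (x - y) / 2) => //; lra.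
- by apply/nbhs_circleP; exists (circle_norm (x - y) / 2) => //; lra.
have := circle_normD (x - z) (z - y).
by rewrite subrKA (circle_distC x z); lra.
Qed.

Lemma circle_compact : compact [set: circle R].
Proof.
have -> : [set: circle R] = @circle_proj R @` `[(- 2^-1 : R), 2^-1].
  apply/seteqP; split=> // x _; exists (circle_val x); last exact: circle_valK.
  by have /andP[h1 h2] := circle_valP x; rewrite /= in_itv /= h1 ltW.
apply: continuous_compact; last exact: segment_compact.
apply: continuous_subspaceT; exact: circle_proj_continuous.
Qed.

Lemma circle_norm_continuous : continuous (@circle_norm R).
Proof.
move=> x; have FF : Filter (nbhs x) by exact: nbhs_filter.
apply/cvgrPdist_lt => e e0; apply/nbhs_circleP; exists e => // y yx.
have := circle_norm_lerB x y; have := circle_norm_lerB y x.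
by rewrite (circle_distC x y) ltr_norml; lra.
Qed.

(** Total boundedness in the form that pigeonhole arguments use: the classes are intervals of
    representatives of length [1 / N < e]. *)
Lemma circle_quantization (e : R) : 0 < e ->
  exists (Q : finType) (q : circle R -> Q),
    forall x y, q x = q y -> circle_norm (x - y) <= e.
Proof.
move=> e0; pose N := (Num.truncn e^-1).+1.
have Ne : (N%:R)^-1 < e.
  by rewrite invf_plt ?posrE// ?ltr0n// truncnS_gt.
pose k x := Num.truncn ((circle_val x + 2^-1) * N%:R).
have kb x : 0 <= (circle_val x + 2^-1) * N%:R < N%:R.
  have /andP[h1 h2] := circle_valP x.
  rewrite mulr_ge0 ?ler0n//=; last lra.
  by rewrite -[ltRHS]mul1r ltr_pM2r ?ltr0n//; lra.
have kN x : (k x < N)%N.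
  have /andP[k1 k2] := kb x; rewrite -(ltr_nat R).
  by apply: le_lt_trans k2; have /andP[] := truncn_itv k1.
exists 'I_N, (fun x => Ordinal (kN x)) => x y [kxy].
have /andP[x1 _] := kb x; have /andP[y1 _] := kb y.
have /andP[] := truncn_itv x1; have /andP[] := truncn_itv y1.
rewrite -/(k x) -/(k y) kxy -natr1; set m := (k y)%:R => a1 a2 b1 b2.
rewrite -(circle_valK x) -(circle_valK y) -circle_projN -circle_projD.
apply: le_trans (circle_norm_proj _) _; apply: le_trans (ltW Ne).
rewrite -[leRHS]mul1r ler_pdivlMr ?ltr0n// -{1}[N%:R]ger0_norm ?ler0n// -normrM.
rewrite ler_norml; lra.
Qed.

End CircleNorm.

(** * Characters and precompact sets *)

Section Characters.
Context {R : realType} {G : topologicalZmodType}.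
Implicit Types (chi xi : G -> circle R) (U V A : set G) (x y : G).

Lemma morph0 chi : {morph chi : x y / x + y} -> chi 0 = 0.
Proof. by move=> chiD; apply: (addrI (chi 0)); rewrite -chiD !addr0. Qed.

Lemma morphN chi : {morph chi : x y / x + y} -> {morph chi : x / - x}.
Proof.
by move=> chiD x; apply: (addrI (chi x)); rewrite -chiD !subrr morph0.
Qed.

Lemma morphB chi : {morph chi : x y / x + y} -> {morph chi : x y / x - y}.
Proof. by move=> chiD x y; rewrite chiD morphN. Qed.

Lemma nbhs_translate x U : nbhs 0 U -> nbhs x [set y | U (y - x)].
Proof.
rewrite -(subrr x) => nU.
apply: (@continuous_comp _ _ _ (fun y => (y, x)) (fun z : G * G => z.1 - z.2)).
- by apply: cvg_pair => /=; [exact: cvg_id|exact: cvg_cst].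
- exact: sub_continuous.
- exact: nU.
Qed.

Arguments nbhs_translate x [U].

Lemma mulrn_continuous n : continuous (fun x : G => x *+ n).
Proof.
elim: n => [|n IH] x; first by apply: cvg_cst.
rewrite /continuous_at mulrS.
under [X in X @ _]eq_fun do rewrite mulrS.
apply: (@continuous_comp _ _ _ (fun y : G => (y, y *+ n)) (fun z : G * G => z.1 + z.2)).
  by apply: cvg_pair => /=; [exact: cvg_id|exact: IH].
exact: add_continuous.
Qed.

(** Combined with [circle_norm_mulrn_le], this neighbourhood forces every character in the polar of
    [U] to be at most [1 / (4 n)] on it. *)
Lemma nbhs_mulrn U n :
  nbhs 0 U -> nbhs 0 [set x | forall j, (j <= n)%N -> U (x *+ j)].
Proof.
move=> nU; elim: n => [|n IH].
  have U0 := nbhs_singleton nU.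
  by apply: filterS nU => x _ [|//] _; rewrite mulr0n.
have : nbhs 0 [set x | U (x *+ n.+1)] by apply: mulrn_continuous; rewrite mul0rn.
move=> h; apply: filterS2 IH h => x /= h1 h2 j.
by rewrite leq_eqVlt ltnS => /orP[/eqP->|/h1].
Qed.

Lemma dual_intro chi : {morph chi : x y / x + y} ->
  (forall e : R, 0 < e -> nbhs 0 [set x | circle_norm (chi x) < e]) -> dual chi.
Proof.
move=> chiD chi0; split=> // x A /nbhs_circleP[e e0 h].
apply: filterS (nbhs_translate x (chi0 _ e0)) => y /=.
by rewrite morphB// => /h.
Qed.

Lemma dual_small chi (e : R) :
  dual chi -> 0 < e -> nbhs 0 [set x | circle_norm (chi x) < e].
Proof.
move=> [chic chiD] e0; apply: (chic 0 [set z | circle_norm z < e]).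
rewrite (morph0 chiD).
by apply/nbhs_circleP; exists e => // y; rewrite subr0.
Qed.

Lemma dual0 : dual (fun _ : G => 0 : circle R).
Proof.
apply: dual_intro => [x y|e e0]; first by rewrite addr0.
by apply: filterS filterT => x _ /=; rewrite circle_norm0.
Qed.

Lemma dualB chi xi : dual chi -> dual xi -> dual (fun x => chi x - xi x).
Proof.
move=> dchi dxi; apply: dual_intro => [x y|e e0].
  by rewrite dchi.2 dxi.2 opprD addrACA.
have e2 : 0 < e / 2 by lra.
apply: filterS2 (dual_small dchi e2) (dual_small dxi e2) => x /= h1 h2.
by apply: le_lt_trans (circle_normB _ _) _; lra.
Qed.

Lemma dualD chi xi : dual chi -> dual xi -> dual (fun x => chi x + xi x).
Proof.
move=> dchi dxi; have := dualB dchi (dualB dual0 dxi).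
by under eq_fun do rewrite sub0r opprK.
Qed.

Lemma dualMn chi n : dual chi -> dual (fun x => chi x *+ n).
Proof.
move=> dchi; elim: n => [|n IH].
  by under eq_fun do rewrite mulr0n; exact: dual0.
by under eq_fun do rewrite mulrS; exact: dualD.
Qed.

Lemma polarP U chi a : polar U chi -> U a -> circle_norm (chi a) <= 4^-1.
Proof. by move=> [_ h]; exact: h. Qed.

Lemma group_precompact1 x : group_precompact [set x].
Proof.
move=> U nU; exists [set x]; split; first exact: finite_set1.
by move=> _ ->; exists x => //; exists 0; [exact: nbhs_singleton|rewrite addr0].
Qed.

Lemma group_precompactU A B :
  group_precompact A -> group_precompact B -> group_precompact (A `|` B).
Proof.
move=> pA pB U nU; have [F [finF AF]] := pA U nU; have [H [finH BH]] := pB U nU.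
exists (F `|` H); split; first by rewrite finite_setU.
by move=> y [/AF|/BH] [f Ff fU]; exists f => //; [left|right].
Qed.

Lemma compact_group_precompact A : compact A -> group_precompact A.
Proof.
(* [compact_cover] is stated for pointed spaces. *)
pose pG : ptopologicalType := HB.pack (TopologicalZmodule.sort G) (isPointed.Build G 0).
rewrite -[compact]/(@compact pG) compact_cover => cA U nU.
have [||D DA AD] := cA G A (fun x => [set y | U (y - x)]°).
- by move=> x _; exact: open_interior.
- by move=> x Ax; exists x => //; exact: nbhs_translate.
eexists; split; first exact: (finite_fset D).
move=> y /AD [x Dx] /interior_subset /= Uyx.
by exists x => //; exists (y - x) => //; rewrite addrC subrK.
Qed.

End Characters.

(** * Characters small on a precompact set and large at one term *)

Lemma infinite_pigeonhole (S : set nat) (Q : finType) (f : nat -> Q) :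
  infinite_set S -> exists c, infinite_set (S `&` f @^-1` [set c]).
Proof.
move=> infS; apply: contrapT => h; apply: infS.
rewrite (_ : S = \bigcup_(c in setT) (S `&` f @^-1` [set c])).
  apply: bigcup_finite => [|c _]; first exact: finite_finset.
  by apply: contrapT => hc; apply: h; exists c.
by apply/seteqP; split=> [n Sn|n [c _ []]//]; exists (f n).
Qed.

Lemma infinite_set_lt (S : set nat) :
  infinite_set S -> exists m n, [/\ S m, S n & (m < n)%N].
Proof.
move=> infS; have [m Sm] := infinite_setN0 infS.
have [n [Sn /negP]] := infinite_setN0 (infinite_setD infS (finite_II m.+1)).
by rewrite -leqNgt => mn; exists m, n.
Qed.

(* The quasiconvex hull of a precompact set is precompact, so it cannot contain
   infinitely many terms of a [V]-separated sequence. *)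
Lemma exists_separating_character {R : realType} {G : topologicalZmodType}
    {V A : set G} {g : nat -> G} {S : set nat} {e : R} :
  nbhs 0 V -> quasiconvex R V -> (forall i j, (i < j)%N -> ~ V (g j - g i)) ->
  group_precompact A -> infinite_set S -> 0 < e ->
  exists n (chi : G -> circle R), [/\ S n, dual chi,
    forall a, A a -> circle_norm (chi a) <= e & 4^-1 < circle_norm (chi (g n))].
Proof.
move=> nV qV gV pA infS e0; apply: contrapT => noex.
(* Under [noex], the multiples of [xi] up to the fourth are at most [e] on [A], so none exceeds 1/4
   at [g n]; hence [xi] itself is at most 1/16 there. *)
have small16 xi n : dual xi -> (forall a, A a -> circle_norm (xi a) <= e / 4) ->
    S n -> circle_norm (xi (g n)) <= 16^-1.
  move=> dxi xiA Sn.
  suff : circle_norm (xi (g n)) *+ 4 <= 4^-1 by rewrite -mulr_natr; lra.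
  apply: circle_norm_mulrn_le => // j j4; rewrite leNgt; apply/negP => big.
  apply: noex; exists n, (fun x => xi x *+ j); split=> //; first exact: dualMn.
  move=> a /xiA xia; apply: le_trans (circle_normMn _ _) _.
  apply: (@le_trans _ _ (circle_norm (xi a) *+ 4)).
    by rewrite ler_wpMn2l// circle_norm_ge0.
  by rewrite -mulr_natr; lra.
(* Chosen so that [1 / (4 M) < e / 12]: on the neighbourhood given by [nbhs_mulrn M], polar
   characters are at most [e / 12]. *)
pose M := (Num.truncn (3 / e)).+1.
have Me : 3 < M%:R * e by rewrite -ltr_pdivrMr// truncnS_gt.
have [_ [/finite_seqP[s ->] AF]] := pA _ (nbhs_mulrn M nV).
have [|Q [q qP]] := @circle_quantization R (e / 12); first by lra.
(* A character is classified by its rounded values at the finitely many centres of the cover of [A];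
   [rep] picks a polar character from each class, with 0 as default for a class that has none. *)
pose cls chi := [ffun i : 'I_(size s) => q (chi s`_i)].
have /choice[rep repP] : forall c : {ffun 'I_(size s) -> Q}, exists r : G -> circle R,
    forall chi, polar V chi -> cls chi = c -> polar V r /\ cls r = c.
  move=> c.
  have [[chi chiP]|no] := pselect (exists chi, polar V chi /\ cls chi = c).
    by exists chi.
  by exists (fun=> 0) => chi h1 h2; case: no; exists chi.
have [|Q' [q' q'P]] := @circle_quantization R 8^-1; first by lra.
(* All representatives are rounded at once, so that each of them varies by at most 1/8 between [g i]
   and [g j]. *)
have [c infc] := infinite_pigeonhole (fun n => [ffun c => q' (rep c (g n))]) infS.
have [i [j [[Si /= ci] [Sj /= cj] ij]]] := infinite_set_lt infc.
(* By quasiconvexity it suffices to bound every polar [chi] by 1/4 at [g j - g i]. Replacing [chi]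
   by its representative [xi] costs 1/16 at each of the two points, and [xi] contributes 1/8. *)
apply: (gV _ _ ij); rewrite -qV => chi chiV.
have [repV repc] := repP _ _ chiV erefl; set xi := rep (cls chi) in repV repc *.
have [dchi dxi] := (chiV.1, repV.1).
have d16 := small16 _ _ (dualB dchi dxi).
have {}d16 n : S n -> circle_norm (chi (g n) - xi (g n)) <= 16^-1.
  apply: d16 => _ /AF [f /(nthP 0)[k ks <-]] [v Vv <-].
  (* The centre, [chi v] and [xi v] contribute [e / 12] each, which gives the [e / 4] required by
     [small16]. *)
  have vs phi : polar V phi -> circle_norm (phi v) <= e / 12.
    move=> phiV.
    have : circle_norm (phi v) *+ M <= 4^-1.
      apply: circle_norm_mulrn_le => // l /Vv /(polarP phiV).
      suff -> : phi (v *+ l) = phi v *+ l by [].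
      elim: l => [|l IH]; first by rewrite !mulr0n morph0//; exact: phiV.1.2.
      by rewrite !mulrS phiV.1.2 IH.
    by rewrite -mulr_natr; nra.
  rewrite dchi.2 dxi.2 opprD addrACA.
  apply: le_trans (circle_normD _ _) _.
  have := circle_normB (chi v) (xi v); have := vs _ chiV; have := vs _ repV.
  have : circle_norm (chi s`_k - xi s`_k) <= e / 12.
    apply: qP; have := congr1 (fun F : {ffun _ -> _} => F (Ordinal ks)) repc.
    by rewrite !ffunE.
  lra.
rewrite -/(circle_norm _) (morphB dchi.2).
have -> : chi (g j) - chi (g i) =
    (chi (g j) - xi (g j)) - (chi (g i) - xi (g i)) + (xi (g j) - xi (g i)).
  by rewrite [RHS]addrAC subrKA opprB subrKA.
apply: le_trans (circle_normD _ _) _.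
have := circle_normB (chi (g j) - xi (g j)) (chi (g i) - xi (g i)).
have := d16 _ Si; have := d16 _ Sj.
have : circle_norm (xi (g j) - xi (g i)) <= 8^-1.
  apply: q'P; have := congr1 (fun F : {ffun _ -> _} => F (cls chi)) (etrans cj (esym ci)).
  by rewrite !ffunE.
lra.
Qed.

(** * Recursive choice of isolating characters *)

Section IsolatingCharacters.
Context {R : realType} {G : topologicalZmodType}.
Variables (V : set G) (g : nat -> G).
Hypotheses (nV : nbhs 0 V) (qV : quasiconvex R V).
Hypothesis gV : forall i j, (i < j)%N -> ~ V (g j - g i).

(** Separating characters are chosen one after the other, each also small at the terms picked
    before. Two of them agree up to [e] along an infinite set of indices; the difference is small
    there and on [A], yet large at the term of the earlier one. *)
Lemma exists_isolating_character (A : set G) (S : set nat) (e : R) :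
  group_precompact A -> infinite_set S -> 0 < e ->
  exists n (psi : G -> circle R) (S' : set nat),
    [/\ S n, dual psi, forall a, A a -> circle_norm (psi a) <= e,
        8^-1 <= circle_norm (psi (g n)) &
        [/\ infinite_set S', S' `<=` S &
            forall m, S' m -> circle_norm (psi (g m)) <= e]].
Proof.
(* The bound [e / 2] keeps a difference of two characters below [e] on [A]; the bound 1/8 leaves
   [1/4 - 1/8] at the selected term. *)
move=> pA infS e0; pose e' := Num.min (e / 2) 8^-1.
have [e'e e'8] : e' <= e / 2 /\ e' <= 8^-1 by rewrite !ge_min !lexx orbT.
have e'0 : 0 < e' by rewrite lt_min; apply/andP; split; lra.
have /choice[pick pickP] : forall B : set G, exists p : nat * (G -> circle R),
    group_precompact B -> [/\ S p.1, dual p.2,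
      forall a, B a -> circle_norm (p.2 a) <= e' & 4^-1 < circle_norm (p.2 (g p.1))].
  move=> B; have [pB|nB] := pselect (group_precompact B); last by exists (0%N, fun=> 0).
  by have [n [chi ?]] := exists_separating_character nV qV gV pB infS e'0; exists (n, chi).
pose B k := iter k (fun B => B `|` [set g (pick B).1]) A.
have pB k : group_precompact (B k).
  by elim: k => //= k pBk; apply: group_precompactU => //; exact: group_precompact1.
have subB i j : (i <= j)%N -> B i `<=` B j.
  elim: j => [|j IH]; first by rewrite leqn0 => /eqP->.
  rewrite leq_eqVlt ltnS => /orP[/eqP->//|/IH ij]; apply: subset_trans ij _.
  exact: subsetUl.
pose n i := (pick (B i)).1; pose chi i := (pick (B i)).2.
have [Sn dchi chiB chin] : [/\ forall i, S (n i), forall i, dual (chi i),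
    forall i a, B i a -> circle_norm (chi i a) <= e' &
    forall i, 4^-1 < circle_norm (chi i (g (n i)))].
  by split=> i; have [] := pickP _ (pB i).
have [Q [q qP]] := circle_quantization e0.
have [c infc] := infinite_pigeonhole
  (fun m => [ffun i : 'I_#|Q|.+1 => q (chi i (g m))]) infS.
(* With one more character than classes, two share their class on the whole infinite set. The order
   [i < j] matters: [g (n i)] lies in [B j], where [chi j] is small. *)
have [i [j [ij cij]]] : exists i j : 'I_#|Q|.+1, (i < j)%N /\ c i = c j.
  apply: contrapT => h; have : injective c; last by move/leq_card; rewrite card_ord ltnn.
  move=> i j cij; apply/val_inj/eqP; apply/negPn; rewrite neq_ltn.
  by apply/negP => /orP[] lt; apply: h; [exists i, j|exists j, i].
exists (n i), (fun x => chi i x - chi j x),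
  (S `&` (fun m => [ffun i : 'I_#|Q|.+1 => q (chi i (g m))]) @^-1` [set c]).
split=> //.
- exact: dualB.
- move=> a Aa; apply: le_trans (circle_normB _ _) _.
  have := chiB i a (subB 0%N _ isT _ Aa); have := chiB j a (subB 0%N _ isT _ Aa).
  lra.
- apply: le_trans (circle_norm_lerB _ _).
  have : circle_norm (chi j (g (n i))) <= e'.
    by apply: chiB; apply: (subB i.+1 j ij); right.
  have := chin i; lra.
- split; [exact: infc|exact: subIsetl|move=> m [_ /= cm]; apply: qP].
  by have := cij; rewrite -cm !ffunE.
Qed.

(** The two halves of the off-diagonal bound come from different sources: later terms are drawn from
    the infinite set on which [psi i] is small, and earlier terms belong to the precompact set on
    which [psi i] was required to be small. *)
Lemma exists_isolating_sequence (K : nat -> set G) (e : nat -> R) :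
  (forall i, group_precompact (K i)) -> (forall i, 0 < e i) ->
  exists (n : nat -> nat) (psi : nat -> G -> circle R),
    [/\ forall i, dual (psi i),
        forall i a, K i a -> circle_norm (psi i a) <= e i,
        forall i, 8^-1 <= circle_norm (psi i (g (n i))) &
        forall i j, i != j -> circle_norm (psi i (g (n j))) <= e i].
Proof.
move=> pK e0.
have /choice[F FP] : forall s : nat * set nat * set G,
    exists t : nat * (G -> circle R) * set nat,
    infinite_set s.1.2 -> group_precompact s.2 ->
    [/\ s.1.2 t.1.1, dual t.1.2,
        forall a, (K s.1.1 `|` s.2) a -> circle_norm (t.1.2 a) <= e s.1.1,
        8^-1 <= circle_norm (t.1.2 (g t.1.1)) &
        [/\ infinite_set t.2, t.2 `<=` s.1.2 &
            forall m, t.2 m -> circle_norm (t.1.2 (g m)) <= e s.1.1]].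
  move=> [[k S] A] /=.
  have [[infS pA]|h] := pselect (infinite_set S /\ group_precompact A); last first.
    by exists (0%N, (fun=> 0), S) => ? ?; case: h.
  have [n [psi [S' h]]] := exists_isolating_character (group_precompactU (pK k) pA) infS (e0 k).
  by exists (n, psi, S').
(* The state holds the indices still available and the terms chosen so far. *)
pose fix st k : set nat * set G := if k is l.+1 then
    let t := F (l, (st l).1, (st l).2) in (t.2, (st l).2 `|` [set g t.1.1])
  else (setT, set0).
pose S k := (st k).1; pose A k := (st k).2.
have [infS pA] : (forall k, infinite_set (S k)) /\ (forall k, group_precompact (A k)).
  apply/all_and2; elim=> [|k [infS pA]].
    by split; [exact: infinite_nat|move=> U _; exists set0; split].
  have [_ _ _ _ [infS' _ _]] := FP (k, S k, A k) infS pA.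
  by split=> //; apply: group_precompactU => //; exact: group_precompact1.
pose n k := (F (k, S k, A k)).1.1; pose psi k := (F (k, S k, A k)).1.2.
have stP k := FP (k, S k, A k) (infS k) (pA k).
have subS i j : (i <= j)%N -> S j `<=` S i.
  elim: j => [|j IH]; first by rewrite leqn0 => /eqP->.
  rewrite leq_eqVlt ltnS => /orP[/eqP->//|/IH ij]; apply: subset_trans ij.
  by have [_ _ _ _ []] := stP j.
have subA i j : (i <= j)%N -> A i `<=` A j.
  elim: j => [|j IH]; first by rewrite leqn0 => /eqP->.
  rewrite leq_eqVlt ltnS => /orP[/eqP->//|/IH ij]; apply: subset_trans ij _.
  exact: subsetUl.
exists n, psi; split=> [i|i a Ka|i|i j].
- by have [] := stP i.
- by have [_ _ h _ _] := stP i; apply: h; left.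
- by have [] := stP i.
- rewrite neq_ltn => /orP[ij|ji].
    have [_ _ _ _ [_ _ h]] := stP i; apply: h; apply: (subS i.+1 j ij).
    by have [] := stP j.
  have [_ _ h _ _] := stP i; apply: h; right; apply: (subA j.+1 i ji).
  by right.
Qed.

End IsolatingCharacters.

(** * Ultrafilter limits and uniform approximation on compact sets *)

Section LimitCharacters.
Context {R : realType}.

Lemma circle_norm_ultralimit (U : set_system nat) (s : nat -> circle R) :
  UltraFilter U ->
  exists z, forall e : R, 0 < e -> U [set N | circle_norm (s N - z) < e].
Proof.
move=> UU; have [z [_ zs]] := @circle_compact R (s @ U) (fmap_proper_filter s _) filterT.
exists z => e e0; have [//|nU] := in_ultra_setVsetC [set N | circle_norm (s N - z) < e] UU.
have sU : (s @ U) (s @` ~` [set N | circle_norm (s N - z) < e]).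
  by rewrite /fmap/=; apply: filterS nU => N nN; exists N.
have zB : nbhs z [set y | circle_norm (y - z) < e] by apply/nbhs_circleP; exists e.
by have [_ [[N nN <-]]] := zs _ _ sU zB.
Qed.

(** One ultrafilter serves all points, so the limits respect addition even where [s N x] does not
    converge. As it refines the eventual filter, closed bounds valid from some [N0] on pass to the
    limit. *)
Lemma exists_limit_morphism {G : zmodType} (s : nat -> G -> circle R) :
  (forall N, {morph s N : x y / x + y}) ->
  exists chi : G -> circle R, {morph chi : x y / x + y} /\
    forall x c r N0, (forall N, (N0 <= N)%N -> circle_norm (s N x - c) <= r) ->
      circle_norm (chi x - c) <= r.
Proof.
move=> sD; have [U [UU Uoo]] := ultraFilterLemma eventually_filter.
have /choice[chi chiP] : forall x : G, exists z, forall e : R, 0 < e ->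
    U [set N | circle_norm (s N x - z) < e].
  by move=> x; exact: circle_norm_ultralimit.
exists chi; split=> [x y|x c r N0 h].
  apply/subr0_eq/circle_norm_eq0/eqP; rewrite eq_le circle_norm_ge0 andbT.
  apply/ler_addgt0Pr => e e0; rewrite add0r.
  have e3 : 0 < e / 3 by lra.
  have [N [[/= hx hy] hxy]] :=
    filter_ex (filterI (filterI (chiP x _ e3) (chiP y _ e3)) (chiP (x + y) _ e3)).
  have -> : chi (x + y) - (chi x + chi y) =
      (s N x - chi x) + (s N y - chi y) - (s N (x + y) - chi (x + y)).
    by rewrite addrACA -sD opprB [RHS]addrC subrKA opprD.
  apply: le_trans (circle_normB _ _) _.
  by have := circle_normD (s N x - chi x) (s N y - chi y); lra.
apply/ler_addgt0Pr => e e0.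
have [N [/= he /h hN]] := filter_ex (filterI (chiP x _ e0) (Uoo _ (nbhs_infty_ge N0))).
have := circle_normD (chi x - s N x) (s N x - c).
by rewrite subrKA (circle_distC (chi x) (s N x)); lra.
Qed.

(** Continuity may be tested on each [K n], where [f] is a uniform limit of continuous functions. *)
Lemma k_omega_continuous {X : topologicalType} (K : nat -> set X) (f : X -> circle R) :
  (forall U : set X, (forall n, open (set_val @^-1` U : set (set_type (K n)))) -> open U) ->
  (forall n (e : R), 0 < e -> exists2 h : X -> circle R, continuous h &
     forall x, K n x -> circle_norm (f x - h x) <= e) ->
  continuous f.
Proof.
move=> openK approx; apply/continuousP => A oA; apply: openK => n.
suff : continuous (f \o (set_val : set_type (K n) -> X)) by move/continuousP; exact.
move=> p B /nbhs_circleP[e e0 eB].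
have [|h hc fh] := approx n (e / 4); first by lra.
have : nbhs p [set y : set_type (K n) |
    circle_norm (h (set_val y) - h (set_val p)) < e / 4].
  have hvc : continuous (h \o (set_val : set_type (K n) -> X)).
    by move=> y; apply: continuous_comp; [exact: initial_continuous|exact: hc].
  apply: (hvc p [set z | circle_norm (z - h (set_val p)) < e / 4]).
  by apply/nbhs_circleP; exists (e / 4) => //; lra.
apply: filterS => y /= hy; apply: eB.
have Kv (z : set_type (K n)) : K n (set_val z) by exact: set_valP.
have := circle_normD (f (set_val y) - h (set_val y)) (h (set_val y) - h (set_val p)).
have := circle_normD (f (set_val y) - h (set_val p)) (h (set_val p) - f (set_val p)).
rewrite !subrKA (circle_distC (h (set_val p)) (f (set_val p))).
by have := fh _ (Kv y); have := fh _ (Kv p); rewrite /=; lra.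
Qed.

Lemma circle_norm_geometric_sum (y : nat -> circle R) (c : R) (m n : nat) :
  0 <= c -> (m <= n)%N ->
  (forall k, (m <= k < n)%N -> circle_norm (y k) <= c / 2 ^+ k.+1) ->
  circle_norm (\sum_(m <= k < n) y k) <= c / 2 ^+ m.
Proof.
(* The induction runs on the sharper bound [c / 2 ^+ m - c / 2 ^+ n]: the subtracted term leaves
   room for the next summand. *)
move=> c0 mn h; apply: (@le_trans _ _ (c / 2 ^+ m - c / 2 ^+ n)); last first.
  by rewrite gerBl divr_ge0// exprn_ge0.
elim: n mn h => [|n IH].
  by rewrite leqn0 => /eqP-> _; rewrite big_geq// circle_norm0 subrr.
rewrite leq_eqVlt => /orP[/eqP<- _|]; first by rewrite big_geq// circle_norm0 subrr.
rewrite ltnS => mn h; rewrite big_nat_recr//=.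
apply: le_trans (circle_normD _ _) _.
have := h n; rewrite mn leqnn => /(_ isT).
have /IH : forall k, (m <= k < n)%N -> circle_norm (y k) <= c / 2 ^+ k.+1.
  by move=> k /andP[mk kn]; rewrite h// mk ltnW.
move=> /(_ mn).
have -> : c / 2 ^+ n = c / 2 ^+ n.+1 + c / 2 ^+ n.+1.
  by rewrite exprS; field; rewrite expf_neq0 ?pnatr_eq0.
lra.
Qed.

End LimitCharacters.

(** * Interpolation of index sets by characters *)

Lemma nbhs0_set_type {G : topologicalZmodType} (W : set G) (W0 : W 0) (A : set G) :
  open W -> nbhs (SigSub (mem_set W0) : set_type W) (set_val @^-1` A) -> nbhs 0 A.
Proof.
move=> oW [_ [[O oO <-] O0] OA].
have : nbhs 0 (O `&` W) by apply: open_nbhs_nbhs; split; [exact: openI|].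
by apply: filterS => x [Ox Wx]; apply: (OA (SigSub (mem_set Wx))).
Qed.

(** Greedy choice: the translates of [V] by the finitely many terms already chosen do not cover the
    range. *)
Lemma exists_separated_subsequence {G : topologicalZmodType} (V : set G) (g : nat -> G) :
  ~ (exists F : set G, finite_set F /\ range g `<=` [set f + u | f in F & u in V]) ->
  exists n : nat -> nat, forall i j, (i < j)%N -> ~ V (g (n j) - g (n i)).
Proof.
move=> noF.
have /choice[F FP] : forall s : seq nat, exists m, forall k, k \in s -> ~ V (g m - g k).
  move=> s; apply: contrapT => h; apply: noF; exists [set g k | k in [set` s]].
  split; first exact/finite_image/finite_seq.
  move=> _ [m _ <-]; apply: contrapT => hm; apply: h; exists m => k ks Vk.
  by apply: hm; exists (g k); [exists k|exists (g m - g k) => //; rewrite addrC subrK].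
pose fix st k : seq nat := if k is l.+1 then F (st l) :: st l else [::].
exists (F \o st) => i j; elim: j => // j IH ij; apply: FP => /=.
suff : F (st i) \in st j.+1 by [].
elim: j ij {IH} => [|j IH]; first by rewrite ltnS leqn0 => /eqP->; rewrite mem_head.
by rewrite ltnS leq_eqVlt => /orP[/eqP->|/IH h]; rewrite inE ?eqxx// h orbT.
Qed.

(** At the [j]-th term the characters other than [psi j] add up to at most 1/32, whereas [psi j] is
    at least 1/8 = 4/32. Whether [j] belongs to [A] thus decides between values above 3/32 and below
    1/32. *)
Lemma exists_interpolating_sequence {R : realType} {G : topologicalZmodType} (g : nat -> G) :
  locally_quasiconvex R G -> locally_k_omega G -> ~ group_precompact (range g) ->
  exists n : nat -> nat, forall A : set nat, exists chi : G -> circle R,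
    [/\ dual chi, forall j, A j -> 3 / 32 <= circle_norm (chi (g (n j))) &
        forall j, ~ A j -> circle_norm (chi (g (n j))) <= 32^-1].
Proof.
move=> lqc [_ lko] npc.
have [V [nV qV noF]] : exists V : set G, [/\ nbhs 0 V, quasiconvex R V &
    ~ (exists F : set G, finite_set F /\ range g `<=` [set f + u | f in F & u in V])].
  apply: contrapT => noV; apply: npc => U nU; have [V [nV qV VU]] := lqc U nU.
  apply: contrapT => noF; apply: noV; exists V; split=> // -[F [finF gF]].
  apply: noF; exists F; split=> // x /gF[f Ff [u Vu <-]].
  by exists f => //; exists u => //; exact: VU.
have [k gV] := exists_separated_subsequence noF.
have [W [oW W0 [_ [K [cK monoK _ openK]]]]] := lko 0.
have pK i : group_precompact (set_val @` K i).
  apply: compact_group_precompact; apply: continuous_compact => //.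
  by apply: continuous_subspaceT; exact: initial_continuous.
have [|n [psi [dpsi psiK psi8 psi_off]]] :=
  (* These weights sum to 1/32, and those with index at least [N] to [32^-1 / 2 ^+ N]. *)
  exists_isolating_sequence nV qV gV (e := fun i => 32^-1 / 2 ^+ i.+1 : R) pK.
  by move=> i; rewrite divr_gt0 ?exprn_gt0 ?invr_gt0.
exists (k \o n) => A.
pose y i x := if i \in A then psi i x else 0.
pose s N x := \sum_(0 <= i < N) y i x.
have ds N : dual (s N).
  elim: N => [|N IH].
    have -> : s 0%N = fun=> 0 by apply/funext => x; rewrite /s big_geq.
    exact: dual0.
  have -> : s N.+1 = fun x => s N x + y N x.
    by apply/funext => x; rewrite /s big_nat_recr.
  by apply: dualD => //; rewrite /y; case: (N \in A) => //; exact: dual0.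
have [chi [chiD chi_lim]] := exists_limit_morphism (fun N => (ds N).2).
have y_le i x c : 0 <= c -> circle_norm (psi i x) <= c -> circle_norm (y i x) <= c.
  by rewrite /y; case: ifP; rewrite ?circle_norm0.
have c0 : 0 <= 32^-1 :> R by rewrite invr_ge0.
have e_ge0 i : 0 <= 32^-1 / 2 ^+ i :> R by rewrite divr_ge0 ?exprn_ge0 ?invr_ge0.
have subK i j : (i <= j)%N -> K i `<=` K j.
  elim: j => [|j IH]; first by rewrite leqn0 => /eqP->.
  rewrite leq_eqVlt ltnS => /orP[/eqP->//|/IH ij]; apply: subset_trans ij _.
  exact: monoK.
(* Since [K i] is contained in all later [K j], every summand from index [i] on is bounded on [K i],
   so the partial sums approximate [chi] uniformly there. *)
have tail i N (x : set_type W) : (i <= N)%N -> K i x ->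
    circle_norm (chi (set_val x) - s N (set_val x)) <= 32^-1 / 2 ^+ N.
  move=> iN Kx; apply: (chi_lim _ _ _ N) => M NM.
  rewrite /s (big_cat_nat (leq0n N) NM)/= addrAC subrr add0r.
  apply: circle_norm_geometric_sum => // j /andP[Nj _].
  apply: y_le => //; apply: psiK; exists x => //.
  by apply: subK Kx; exact: leq_trans Nj.
have dchi : dual chi.
  (* Continuity on the open neighbourhood [W] of 0 suffices, because [chi] is a homomorphism. *)
  have cW : continuous (chi \o (set_val : set_type W -> G)).
    apply: (k_omega_continuous (K := K)) => [U /openK//|i e e0].
    have [N iN Ne] : exists2 N, (i <= N)%N & 32^-1 / 2 ^+ N <= e.
      exists (maxn i (Num.truncn e^-1).+1); first exact: leq_maxl.
      set N := maxn _ _.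
      have : e^-1 < N%:R.
        by apply: lt_le_trans (truncnS_gt _) _; rewrite ler_nat leq_maxr.
      have : N%:R < 2 ^+ N :> R by rewrite -natrX ltr_nat ltn_expl.
      rewrite ler_pdivrMr ?exprn_gt0// -div1r ltr_pdivrMr//; nra.
    exists (s N \o set_val); last by move=> x Kx; apply: le_trans Ne; exact: tail Kx.
    move=> x; apply: continuous_comp; first exact: initial_continuous.
    exact: (ds N).1.
  apply: dual_intro => // e e0; apply: (nbhs0_set_type (W0 := W0)) => //.
  apply: (cW _ [set z | circle_norm z < e]).
  apply/nbhs_circleP; exists e => // z /=; rewrite morph0// subr0//.
have off i j : i != j -> circle_norm (y i (g (k (n j)))) <= 32^-1 / 2 ^+ i.+1.
  by move=> ij; apply: y_le => //; exact: psi_off.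
exists chi; split=> // j Aj; rewrite /=; have := off^~ j; have := psi8 j.
  set x := g (k (n j)) => psi8j offj.
  have : circle_norm (chi x - psi j x) <= 32^-1.
    (* From [j.+1] on the partial sums contain the summand [psi j]; removing it leaves a sum whose
       [j]-th entry is 0. *)
    apply: (chi_lim _ _ _ j.+1) => M jM.
    have -> : s M x - psi j x =
        \sum_(0 <= i < M) (y i x - (if i == j then psi j x else 0)).
      by rewrite sumrB; congr (_ - _); rewrite -big_mkcond big_nat1_eq /= jM.
    rewrite -[leRHS]divr1 -(expr0 2); apply: circle_norm_geometric_sum => // i _.
    have [->|ij] := eqVneq i j; last by rewrite subr0 offj.
    by rewrite /y mem_set// subrr circle_norm0.
  have := circle_norm_lerB (psi j x) (psi j x - chi x).
  by rewrite subKr circle_distC; lra.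
set x := g (k (n j)) => _ offj.
rewrite -[X in circle_norm X]subr0; apply: (chi_lim _ _ _ 0%N) => M _; rewrite subr0.
rewrite -[leRHS]divr1 -(expr0 2); apply: circle_norm_geometric_sum => // i _.
have [->|/offj//] := eqVneq i j.
by rewrite /y memNset// circle_norm0.
Qed.

(** * Extension of characters to the Bohr compactification *)

(** An alias that carries the circle's addition as a multiplicative group law, the form in which
    [bohr_extension] takes its targets. *)
Definition mul_circle (R : realType) : Type := circle R.

Section MulCircle.
Variable R : realType.

HB.instance Definition _ := Topological.copy (mul_circle R) (circle R).
HB.instance Definition _ := isGroup.Build (mul_circle R)
  (@addrA (circle R)) (@add0r (circle R)) (@addr0 (circle R))
  (@addNr (circle R)) (@addrN (circle R)).
HB.instance Definition _ := isTopologicalGroup.Build (mul_circle R)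
  (@add_continuous (circle R)) (@opp_continuous (circle R)).

End MulCircle.

Lemma bohr_extend_character {R : realType} {G : topologicalZmodType}
    {bG : topologicalGroupType} {b : G -> bG} (chi : G -> circle R) :
  is_bohr_compactification b -> dual chi ->
  exists2 F : bG -> circle R, continuous F & forall x, F (b x) = chi x.
Proof.
move=> bohr [chic chiD].
have [F [Fc _ Fb]] := @bohr_extension _ _ _ bohr (mul_circle R) chi
  (@circle_compact R) (@circle_hausdorff R) chic chiD.
by exists F => // x; rewrite Fb.
Qed.

(* [truncation t] is the point of [-1, 1] nearest to [t], written without case
   distinction so that its continuity is immediate. *)
Definition truncation {R : realType} (t : R) : R := (`|t + 1| - `|t - 1|) / 2.

(** * From signs to bounded real and complex functions *)

Section Interpolation.
Context {R : realType} {X : topologicalType} (h : nat -> X).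

Lemma exists_sign_function (F : X -> circle R) (A : set nat) :
  continuous F -> (forall j, A j -> 3 / 32 <= circle_norm (F (h j))) ->
  (forall j, ~ A j -> circle_norm (F (h j)) <= 32^-1) ->
  exists phi : X -> R, [/\ continuous phi, forall x, `|phi x| <= 1,
    forall j, A j -> phi (h j) = 1 & forall j, ~ A j -> phi (h j) = -1].
Proof.
(* The affine map sends 3/32 to 1 and 1/32 to -1; truncation then makes the values at the [h j]
   exact. *)
move=> Fc FA FnA; pose phi x := truncation (32 * circle_norm (F x) - 2).
exists phi; split.
- move=> x; have Nc : circle_norm (F y) @[y --> x] --> circle_norm (F x).
    by apply: (@continuous_comp _ _ R F circle_norm); [exact: Fc|exact: circle_norm_continuous].
  have tc : 32 * circle_norm (F y) - 2 @[y --> x] --> 32 * circle_norm (F x) - 2.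
    by apply: cvgB; [apply: cvgM; [exact: cvg_cst|exact: Nc]|exact: cvg_cst].
  apply: cvgM; last exact: cvg_cst.
  by apply: cvgB; apply: cvg_norm; [apply: cvgD|apply: cvgB] => //; exact: cvg_cst.
- move=> x; rewrite /phi /truncation; set t := _ - 2.
  have := lerB_dist (t + 1) (t - 1); have := lerB_dist (t - 1) (t + 1).
  have -> : t + 1 - (t - 1) = 2 by lra.
  have -> : t - 1 - (t + 1) = - 2 by lra.
  by rewrite normrN (ger0_norm (ler0n _ 2)) ler_norml; lra.
- move=> j /FA; rewrite /phi /truncation; set t := circle_norm _ => ht.
  by rewrite !ger0_norm; lra.
- move=> j /FnA; rewrite /phi /truncation; set t := circle_norm _ => ht.
  by rewrite !ler0_norm; lra.
Qed.

(* If signs can be interpolated, then the binary digits of a real function can,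
   hence so can the function. *)
Lemma exists_real_interpolation (u : nat -> R) (M : R) :
  (forall A : set nat, exists phi : X -> R, [/\ continuous phi, forall x, `|phi x| <= 1,
    forall j, A j -> phi (h j) = 1 & forall j, ~ A j -> phi (h j) = -1]) ->
  (forall j, `|u j| <= M) ->
  exists2 F : X -> R, continuous F & forall j, F (h j) = u j.
Proof.
move=> /choice[phi phiP] uM.
have M0 : 0 <= M by apply: le_trans (normr_ge0 _) (uM 0%N).
pose c k : R := M / 2 ^+ k.
have c0 k : 0 <= c k by rewrite divr_ge0 ?exprn_ge0.
have cS k : c k = c k.+1 + c k.+1.
  by rewrite /c exprS; field; rewrite expf_neq0 ?pnatr_eq0.
(* [r k] is the remainder after [k] digits. Subtracting the sign of the remainder with weight
   [c k.+1] halves its bound. *)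
pose fix r k : nat -> R := if k is l.+1 then
  fun j => r l j - c l.+1 * phi [set j | 0 <= r l j] (h j) else u.
pose F k x := \sum_(0 <= l < k) c l.+1 * phi [set j | 0 <= r l j] x.
have FS k x : F k.+1 x = F k x + c k.+1 * phi [set j | 0 <= r k j] x.
  by rewrite /F big_nat_recr.
have r_le k j : `|r k j| <= c k.
  elim: k => [|k]; first by rewrite /c expr0 divr1.
  have [_ _ pos neg] := phiP [set j | 0 <= r k j]; rewrite (cS k) /= !ler_norml.
  have [rk|rk] := leP 0 (r k j); first by rewrite pos//; lra.
  by rewrite neg ?mulrN1; [lra|apply/negP; rewrite -ltNge].
have uF k j : u j = F k (h j) + r k j.
  elim: k => [|k IH]; first by rewrite /F big_geq// add0r.
  by rewrite FS /= addrAC -addrA subrK.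
have Fc k : continuous (F k).
  elim: k => [|k IH] x.
    have -> : F 0%N = fun=> 0 by apply/funext => y; rewrite /F big_geq.
    exact: cvg_cst.
  rewrite (funext (FS k)); apply: cvgD; first exact: IH.
  apply: cvgM; first exact: cvg_cst.
  by have [phic _ _ _] := phiP [set j | 0 <= r k j]; exact: phic.
(* The intervals with centre [F k x] and radius [c k] are nested, since each step moves the centre
   by at most the loss in radius. *)
have step k x : F k x - c k <= F k.+1 x - c k.+1 /\ F k.+1 x + c k.+1 <= F k x + c k.
  rewrite FS (cS k); have [_ /(_ x) + _ _] := phiP [set j | 0 <= r k j].
  by rewrite ler_norml => /andP[p1 p2]; have := c0 k.+1; split; nra.
have mono k m x : (k <= m)%N -> F k x - c k <= F m x - c m /\ F m x + c m <= F k x + c k.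
  elim: m => [|m IH]; first by rewrite leqn0 => /eqP->.
  rewrite leq_eqVlt ltnS => /orP[/eqP->//|/IH[h1 h2]].
  by have [s1 s2] := step m x; lra.
(* The supremum of the left ends lies in every interval, so [L] is the uniform limit of the
   [F k]. *)
pose L x := sup [set F k x - c k | k in setT].
have LF k x : `|L x - F k x| <= c k.
  have ub m : F m x - c m <= F k x + c k.
    have [mk|/ltnW km] := leqP m k.
      by have [h1 _] := mono _ _ x mk; have := c0 k; lra.
    by have [_ h2] := mono _ _ x km; have := c0 m; lra.
  have h1 : F k x - c k <= L x.
    apply: ub_le_sup; last by exists k.
    by exists (F k x + c k) => _ [m _ <-]; exact: ub.
  have h2 : L x <= F k x + c k.
    by apply: ge_sup => [|_ [m _ <-]]; [exists (F k x - c k), k|exact: ub].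
  by rewrite ler_norml; lra.
have c_small e : 0 < e -> exists k, c k < e.
  move=> e0; exists (Num.truncn (M / e)).+1; set k := _.+1.
  have : M / e < k%:R by exact: truncnS_gt.
  have : k%:R < 2 ^+ k :> R by rewrite -natrX ltr_nat ltn_expl.
  rewrite ltr_pdivrMr// /c [_ / _ ^+ _ < _]ltr_pdivrMr ?exprn_gt0//; nra.
exists L => [x|j].
  apply/cvgrPdist_le => e e0; have [|k ck] := c_small (e / 3); first lra.
  have e3 : 0 < e / 3 by lra.
  have /cvgrPdist_le/(_ _ e3) := Fc k x.
  apply: filterS => y Fxy.
  have := LF k x; have := LF k y; move: Fxy; rewrite !ler_norml; lra.
apply/eqP; rewrite -subr_eq0 -normr_le0; apply/ler_addgt0Pr => e e0; rewrite add0r.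
have [|k ck] := c_small (e / 2); first lra.
have := LF k (h j); have := r_le k j; rewrite (uF k j) !ler_norml; lra.
Qed.

Lemma exists_complex_interpolation (u : nat -> R[i]) (M : R) :
  (forall A : set nat, exists phi : X -> R, [/\ continuous phi, forall x, `|phi x| <= 1,
    forall j, A j -> phi (h j) = 1 & forall j, ~ A j -> phi (h j) = -1]) ->
  (forall j, `|u j| <= M%:C%C) ->
  exists2 F : X -> R[i]^o, continuous F & forall j, F (h j) = u j.
Proof.
move=> sgn uM.
have le_part (a b : R) : `|a| <= Num.sqrt (a ^+ 2 + b ^+ 2).
  by rewrite -sqrtr_sqr ler_sqrt ?lerDl ?addr_ge0 ?sqr_ge0.
have uM' j : Num.sqrt (complex.Re (u j) ^+ 2 + complex.Im (u j) ^+ 2) <= M.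
  by have := uM j; rewrite normc_def lecR.
have [|F Fc Fu] := @exists_real_interpolation (fun j => complex.Re (u j)) M sgn.
  by move=> j; apply: le_trans (uM' j); exact: le_part.
have [|H Hc Hu] := @exists_real_interpolation (fun j => complex.Im (u j)) M sgn.
  by move=> j; apply: le_trans (uM' j); rewrite addrC; exact: le_part.
exists (fun x => (F x +i* H x)%C) => [x|j]; last first.
  by rewrite Fu Hu; case: (u j).
apply/cvgrPdist_le => e e0.
(* In the order of [R[i]], a positive element is real. *)
have [e'0 ->] : 0 < complex.Re e /\ e = (complex.Re e)%:C%C.
  by case: e e0 => a d; rewrite ltcE /= => /andP[/eqP-> a0].
have e2 : 0 < complex.Re e / 2 by lra.
have /cvgrPdist_le/(_ _ e2) nF := Fc x; have /cvgrPdist_le/(_ _ e2) nH := Hc x.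
apply: filterS2 nF nH => y /= Fy Hy; rewrite normc_def lecR /=.
move: (F x - F y) (H x - H y) Fy Hy => a d Fy Hy.
have : Num.sqrt (a ^+ 2 + d ^+ 2) <= `|a| + `|d|.
  rewrite -[leRHS]ger0_norm ?addr_ge0// -sqrtr_sqr ler_sqrt ?sqr_ge0//.
  rewrite sqrrD !real_normK ?num_real//.
  by rewrite [leRHS]addrAC lerDl mulrn_wge0// mulr_ge0.
lra.
Qed.

End Interpolation.

(** * Extraction of the I_0-set *)

Theorem theorem4 (R : realType) (G : topologicalZmodType)
    (bG : topologicalGroupType) (b : G -> bG) (g : nat -> G) :
  is_bohr_compactification b ->
  locally_quasiconvex R G ->
  locally_k_omega G ->
  ~ group_precompact (range g) ->
  exists E : set G, [/\ E `<=` range g, infinite_set E & I0_set R b E].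
Proof.
move=> bohr lqc lko npc.
have [n nP] := exists_interpolating_sequence lqc lko npc.
pose h j := g (n j); exists (range h); split.
- by move=> _ [j _ <-]; exists (n j).
- have h_inj : {in [set: nat] &, injective h}.
    move=> i j _ _ hij; apply: contrapT => ij.
    (* The character interpolating the singleton of [i] separates [h i] from every other [h j], so
       [h] is injective and its range infinite. *)
    have [chi [_ /(_ i erefl) h1 h2]] := nP [set i].
    by have := h2 j (fun ji => ij (esym ji)); rewrite -/(h j) -hij /h; lra.
  by apply/infiniteP; rewrite (card_le_eqr (inj_card_eq h_inj)) card_lexx.
- move=> f [M fM].
  have [||F Fc Fh] := @exists_complex_interpolation R bG (b \o h) (f \o h) M.
  + move=> A; have [chi [dchi chiA chinA]] := nP A.
    have [F Fc Fb] := bohr_extend_character bohr dchi.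
    by apply: (exists_sign_function (F := F)) => // j; rewrite /= Fb; [exact: chiA|exact: chinA].
  + by move=> j; apply: fM; exists j.
  + by exists F; split=> // _ [j _ <-]; exact: Fh.
Qed.
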